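(* Let $s,t\ge 1$ be integers. Then $\chi_p(P_{2t}\Diamond_2 C_{4s})\le 3$ if $t=1$, $\chi_p(P_{2t}\Diamond_2 C_{4s})\le 4$ if $2\le t\le 3$, and $\chi_p(P_{2t}\Diamond_2 C_{4s})\le 5$ if $t\ge 4$. Moreover, equality holds for $t\in\{1,2,3\}$.
   Context: A packing $k$-coloring of a graph $H$ is a map $c:V(H)\to\{1,\ldots,k\}$ such that any two distinct vertices $u,v$ with $c(u)=c(v)=i$ satisfy $d_H(u,v)\ge i+1$ (distance in $H$). The packing chromatic number $\chi_p(H)$ is the least $k$ for which a packing $k$-coloring exists. $P_m$ denotes the path $v_1\cdots v_m$ and $C_n$ the cycle on $n$ vertices. Path-aligned product: for positive integers $\ell\mid m$ and a connected vertex-transitive graph $G$ containing $P_\ell$ as a subgraph, $P_m\Diamond_\ell G$ is formed from the path $P_m=v_1\cdots v_m$ and $m/\ell$ pairwise disjoint copies of $G$, where for each $1\le i\le m/\ell$ the consecutive path vertices $v_{(i-1)\ell+1},\ldots,v_{i\ell}$ are identified, in order, with the vertices of a path $P_\ell$ (i.e. $\ell$ consecutive cycle vertices when $G$ is a cycle) in the $i$-th copy of $G$. *)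

(* Defs.v *)
From mathcomp Require Import all_boot.

Set Implicit Arguments.
Unset Strict Implicit.
Unset Printing Implicit Defensive.

(* A finite simple graph is a symmetric irreflexive e : rel T on a finType T. *)

Section Distance.

Variables (T : finType) (e : rel T).

Definition has_walk (n : nat) (x y : T) : bool :=
  [exists w : n.-tuple T, path e x w && (last x w == y)].

(* Only meaningful when connect e x y; its value is then characterised by
   dist_leq and dist_walk below. *)
Definition dist (x y : T) : nat :=
  find (fun n => has_walk n x y) (iota 0 #|T|).

Lemma has_walkP n x y :
  reflect (exists w : seq T, [/\ path e x w, last x w = y & size w = n])
          (has_walk n x y).
Proof.
apply: (iffP existsP) => [[w /andP[pw /eqP lw]]|[w [pw lw sw]]].
  by exists w; rewrite size_tuple.
by move/eqP: sw => sw; exists (Tuple sw); rewrite /= pw lw eqxx.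
Qed.

Lemma has_walk_short x y :
  connect e x y -> has (fun n => has_walk n x y) (iota 0 #|T|).
Proof.
case/connectP=> w pw ->; case/shortenP: pw => w' pw' uw' _.
apply/hasP; exists (size w').
  rewrite mem_iota add0n leq0n.
  by have := max_card (mem (x :: w')); rewrite (card_uniqP uw').
by apply/has_walkP; exists w'.
Qed.

Lemma dist_walk x y : connect e x y ->
  exists w : seq T, [/\ path e x w, last x w = y & size w = dist x y].
Proof.
move=> cxy; have hs := has_walk_short cxy.
have := nth_find 0 hs; rewrite nth_iota ?add0n; last first.
  by move: hs; rewrite has_find size_iota.
by move/has_walkP.
Qed.

Lemma dist_leq x w : path e x w -> dist x (last x w) <= size w.
Proof.
move=> pw; rewrite leqNgt; apply/negP=> lt.
have := before_find 0 lt; rewrite nth_iota ?add0n; last first.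
  apply: leq_trans lt _; rewrite /dist.
  by have := find_size (fun n => has_walk n x (last x w)) (iota 0 #|T|);
     rewrite size_iota.
have hw : has_walk (size w) x (last x w) by apply/has_walkP; exists w.
by rewrite hw.
Qed.

End Distance.

Section PackingColoring.

Variables (T : finType) (e : rel T).

(* The element i : 'I_k stands for the colour i.+1 of {1, ..., k}. *)
Definition colour (k : nat) (i : 'I_k) : nat := i.+1.

(* Vertices in different components are at infinite distance. *)
Definition packing_coloring (k : nat) (c : {ffun T -> 'I_k}) : bool :=
  [forall u, forall v,
     [&& u != v, c u == c v & connect e u v] ==>
     (colour (c u) + 1 <= dist e u v)].

Definition packing_colorable (k : nat) : bool :=
  [exists c : {ffun T -> 'I_k}, packing_coloring c].

Lemma packing_colorable_card : exists k, packing_colorable k.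
Proof.
exists #|T|; apply/existsP; exists [ffun u => enum_rank u].
apply/forallP=> u; apply/forallP=> v; apply/implyP=> /and3P[uv].
by rewrite !ffunE (inj_eq enum_rank_inj) (negbTE uv).
Qed.

Definition packing_chromatic_number : nat := ex_minn packing_colorable_card.

End PackingColoring.

Definition cycle_graph (n : nat) : rel 'I_n :=
  fun i j => (i.+1 %% n == j) || (j.+1 %% n == i).

Definition is_path_in (T : finType) (e : rel T) (l : nat) (q : 'I_l -> T) :
    Prop :=
  injective q /\ (forall a b : 'I_l, b = a.+1 :> nat -> e (q a) (q b)).

(* The path-aligned product of P_m and (T, e), for l %| m, where q i is the
   path P_l chosen in the i-th copy of (T, e).  After the identifications every
   vertex lies in exactly one copy, so (i, x) is the vertex x of the i-th copy;
   counting from 0, the path vertex v_(i * l + a) is (i, q i a).  Edges are the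
   edges of the copies and those of P_m. *)
Definition path_aligned_product (m l : nat) (T : finType) (e : rel T)
    (q : 'I_(m %/ l) -> 'I_l -> T) : rel ('I_(m %/ l) * T) :=
  fun u v =>
    (u.1 == v.1) && e u.2 v.2
    || [exists a : 'I_l, exists b : 'I_l,
          [&& u.2 == q u.1 a, v.2 == q v.1 b
            & ((u.1 * l + a).+1 == v.1 * l + b)
              || ((v.1 * l + b).+1 == u.1 * l + a)]].

(* Main.v *)
Require Import Defs.
From mathcomp Require Import all_boot.
From mathcomp Require Import zify_ssreflect.

(** Put coordinates [0, ..., 4s - 1] on the [i]-th cycle so that the path runs
    through [0] and [1].  For the upper bounds, colour even coordinates [1],
    coordinates congruent to [3] mod 4 with [3], and coordinates congruent to
    [1] mod 4 with [2], except that coordinate [1] of every other cycle receives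
    alternately [4] and [5].  With one cycle only the colours up to [3] occur,
    and with at most three cycles only those up to [4].

    For the lower bounds, four consecutive vertices of a cycle cannot be
    coloured with [1, 2].  A path on five vertices admits only eight colourings
    with [1, 2, 3], and no two of them, on the vertices at distance at most [2]
    from [x] in one cycle and from [y] in another, are compatible with an edge
    between [x] and [y]. *)

Set Implicit Arguments.
Unset Strict Implicit.
Unset Printing Implicit Defensive.

(** * Walks and distances *)

Section Walks.

Variables (T : finType) (e : rel T).

Lemma has_walk0 x : has_walk e 0 x x.
Proof. by apply/has_walkP; exists [::]. Qed.

Lemma has_walk1 x y : e x y -> has_walk e 1 x y.
Proof. by move=> exy; apply/has_walkP; exists [:: y]; rewrite /= exy. Qed.

Lemma has_walkD m n x y z :
  has_walk e m x y -> has_walk e n y z -> has_walk e (m + n) x z.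
Proof.
case/has_walkP=> w [pw lw <-] /has_walkP[w' [pw' lw' <-]].
apply/has_walkP; exists (w ++ w').
by rewrite cat_path last_cat lw pw pw' lw' size_cat.
Qed.

Lemma has_walk_sym n x y :
  symmetric e -> has_walk e n x y -> has_walk e n y x.
Proof.
move=> se /has_walkP[w [pw <- <-]]; apply/has_walkP.
exists (rev (belast x w)); split.
- by rewrite (eq_path (e' := fun a b => e b a)) ?rev_path // => a b; rewrite se.
- by case: w {pw} => //= a w; rewrite rev_cons last_rcons.
- by rewrite size_rev size_belast.
Qed.

Lemma has_walk_connect n x y : has_walk e n x y -> connect e x y.
Proof. by case/has_walkP=> w [pw lw _]; apply/connectP; exists w. Qed.

Lemma dist_has_walk n x y : has_walk e n x y -> dist e x y <= n.
Proof. by case/has_walkP=> w [pw <- <-]; apply: dist_leq. Qed.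

Lemma lipschitz_leq_dist (D : T -> nat) x y :
    D x = 0 -> (forall a b, e a b -> D b <= (D a).+1) ->
  connect e x y -> D y <= dist e x y.
Proof.
move=> Dx De /dist_walk[w [pw <- <-]].
rewrite -[size w]addn0 -Dx; elim: w x {Dx} pw => //= a w IH x /andP[exa pw].
by apply: leq_trans (IH _ pw) _; rewrite addSn -addnS leq_add2l De.
Qed.

Lemma packing_coloring_walk k (c : {ffun T -> 'I_k}) n x y :
    packing_coloring e c -> x != y -> has_walk e n x y ->
  c x = c y -> colour (c x) < n.
Proof.
move=> /forallP/(_ x)/forallP/(_ y)/implyP pc xy wxy cxy.
have := pc; rewrite xy cxy eqxx (has_walk_connect wxy) addn1 => /(_ isT) lt.
exact: leq_trans lt (dist_has_walk wxy).
Qed.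

Lemma packing_chromatic_number_leq k :
  packing_colorable e k -> packing_chromatic_number e <= k.
Proof. by move=> ck; rewrite /packing_chromatic_number; case: ex_minnP => m _; apply. Qed.

Lemma packing_chromatic_number_gtn k :
    (forall m (c : {ffun T -> 'I_m}), m <= k -> ~ packing_coloring e c) ->
  k < packing_chromatic_number e.
Proof.
move=> H; rewrite /packing_chromatic_number; case: ex_minnP => m /existsP[c pc] _.
by rewrite ltnNge; apply/negP => /H /(_ pc).
Qed.

End Walks.

(** * Words over the colours *)

(* The letter [x] may be put in front of [w] if its colour class stays a
   packing; only distances up to [3] are tested, because vertices that far
   apart along a cycle of length at least [4] are certainly distinct. *)
Definition compatible (x : nat) (w : seq nat) : bool :=
  all (fun i => (nth 0 w i == x) ==> (x <= i)) (iota 0 3).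

Fixpoint packing_words (k m : nat) : seq (seq nat) :=
  if m is m'.+1 then
    [seq x :: w | w <- packing_words k m', x <- [seq x <- iota 1 k | compatible x w]]
  else [:: [::]].

Lemma mem_packing_words (f : nat -> nat) k b m :
    (forall j, 0 < f j <= k) ->
    (forall j d, 0 < d <= 3 -> f j = f (j + d) -> f j < d) ->
  [seq f j | j <- iota b m] \in packing_words k m.
Proof.
move=> fk fd; elim: m b => [|m IH] b //=.
apply/allpairsPdep; exists [seq f j | j <- iota b.+1 m], (f b).
split=> //; rewrite mem_filter mem_iota andbC add1n ltnS fk /=.
apply/allP=> i; rewrite mem_iota /= => i3.
apply/implyP => /eqP; case: (ltnP i m) => im.
  rewrite (nth_map 0) ?size_iota // nth_iota // addSnnS => /esym /fd.
  by rewrite ltnS; apply; rewrite /= ltnS; lia.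
rewrite nth_default ?size_map ?size_iota // => fb.
by have := fk b; rewrite -fb.
Qed.

Lemma packing_words_2_4 : packing_words 2 4 = [::].
Proof. by []. Qed.

(* The two words are read along two cycles, centred at the ends (position [2])
   of an edge joining them. *)
Definition joinable (a b : seq nat) : bool :=
  all (fun i => all (fun j =>
    (nth 0 a i == nth 0 b j) ==>
    (nth 0 a i <= (i - 2) + (2 - i) + ((j - 2) + (2 - j)))) (iota 0 5)) (iota 0 5).

Lemma not_joinable a b :
  a \in packing_words 3 5 -> b \in packing_words 3 5 -> ~~ joinable a b.
Proof.
have: all (fun a => all (fun b => ~~ joinable a b) (packing_words 3 5))
        (packing_words 3 5) by vm_compute.
by move=> /allP H /H /allP; apply.
Qed.

(** * Cycles *)

Lemma modnS_small n i : i < n -> i.+1 %% n = if i.+1 == n then 0 else i.+1.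
Proof.
move=> lt; case: eqP => [->|/eqP ne]; first by rewrite modnn.
by rewrite modn_small // ltn_neqAle ne.
Qed.

Definition cyc_ord n (n0 : 0 < n) k : 'I_n := Ordinal (ltn_pmod k n0).

Lemma cyc_ordE n (n0 : 0 < n) k (x : 'I_n) : k = x %[mod n] -> cyc_ord n0 k = x.
Proof. by move=> kx; apply/val_inj; rewrite /= kx modn_small. Qed.

Lemma cyc_ord_adj n (n0 : 0 < n) k :
  cycle_graph (cyc_ord n0 k) (cyc_ord n0 k.+1).
Proof. by rewrite /cycle_graph /= -addn1 modnDml addn1 eqxx. Qed.

Lemma cyc_ord_neq n (n0 : 0 < n) k d :
  0 < d < n -> cyc_ord n0 k != cyc_ord n0 (k + d).
Proof.
move=> /andP[d0 dn]; rewrite -val_eqE /= -{1}[k]addn0 eqn_modDl mod0n.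
by rewrite modn_small // eq_sym -lt0n.
Qed.

Lemma cycle_graph_sym n : symmetric (@cycle_graph n).
Proof. by move=> x y; rewrite /cycle_graph orbC. Qed.

(* The residue of [x - a] modulo [n], for [a, x < n]. *)
Definition csub (n a x : nat) : nat := if a <= x then x - a else x + n - a.

Definition csucc (n x y : nat) : bool := if x.+1 == n then y == 0 else y == x.+1.

Definition cadj (n x y : nat) : bool := csucc n x y || csucc n y x.

Lemma cycle_graph_cadj n (x y : 'I_n) : cycle_graph x y = cadj n x y.
Proof.
rewrite /cycle_graph /cadj /csucc !modnS_small //.
by congr (_ || _); case: ifP => _; rewrite eq_sym.
Qed.

Lemma ltn_csub n a x : a < n -> x < n -> csub n a x < n.
Proof. by rewrite /csub; case: ifP; lia. Qed.

Lemma csub_injr n a x y :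
  a < n -> x < n -> y < n -> csub n a x = csub n a y -> x = y.
Proof. by rewrite /csub; do ![case: ifP => ?]; lia. Qed.

Lemma csub_injl n a x y :
  a < n -> x < n -> y < n -> csub n x a = csub n y a -> x = y.
Proof. by rewrite /csub; do ![case: ifP => ?]; lia. Qed.

Lemma csub_succr n a x y :
  a < n -> x < n -> y < n -> csucc n x y -> csucc n (csub n a x) (csub n a y).
Proof.
move=> an xn yn; rewrite {1}/csucc.
by case: eqP => nx /eqP yE; rewrite /csub {y}yE ?leq0n in yn *;
  do ![case: ifP => ?]; rewrite /csucc; case: ifP => ?; lia.
Qed.

Lemma csub_succl n a x y :
  a < n -> x < n -> y < n -> csucc n x y -> csucc n (csub n y a) (csub n x a).
Proof.
move=> an xn yn; rewrite {1}/csucc.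
by case: eqP => nx /eqP yE; rewrite /csub {y}yE ?leq0n in yn *;
  do ![case: ifP => ?]; rewrite /csucc; case: ifP => ?; lia.
Qed.

(* The coordinate of [x] on the cycle [0, ..., n - 1] that gives [a] and its
   neighbour [b] the coordinates [0] and [1]. *)
Definition coord (n a b x : nat) : nat :=
  if csucc n a b then csub n a x else csub n x a.

Lemma ltn_coord n a b x : a < n -> x < n -> coord n a b x < n.
Proof. by rewrite /coord => an xn; case: ifP => _; apply: ltn_csub. Qed.

Lemma coord_inj n a b x y :
  a < n -> x < n -> y < n -> coord n a b x = coord n a b y -> x = y.
Proof.
by rewrite /coord => an xn yn; case: ifP => _; [apply: csub_injr | apply: csub_injl].
Qed.

Lemma coord0 n a b : coord n a b a = 0.
Proof. by rewrite /coord /csub leqnn subnn if_same. Qed.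

Lemma coord1 n a b : 1 < n -> a < n -> b < n -> cadj n a b -> coord n a b b = 1.
Proof.
move=> n1 an bn; rewrite /cadj /coord; case: ifP => [|_] /=; rewrite /csucc /csub;
  by do ![case: ifP => ?]; lia.
Qed.

Lemma coord_adj n a b x y :
    a < n -> x < n -> y < n -> cadj n x y ->
  cadj n (coord n a b x) (coord n a b y).
Proof.
move=> an xn yn /orP[] xy; apply/orP; rewrite /coord; case: ifP => _.
- by left; apply: csub_succr.
- by right; apply: csub_succl.
- by right; apply: csub_succr.
- by left; apply: csub_succl.
Qed.

Definition cdist (n p r : nat) : nat :=
  minn ((p - r) + (r - p)) (n - ((p - r) + (r - p))).

Lemma cdistC n p r : cdist n p r = cdist n r p.
Proof. by rewrite /cdist addnC. Qed.

Lemma cdist_adj n p r r' :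
  p < n -> r < n -> r' < n -> cadj n r r' -> cdist n p r' <= (cdist n p r).+1.
Proof.
by move=> pn rn rn' /orP[]; rewrite /csucc; case: eqP => nr /eqP rE;
  rewrite /cdist rE; lia.
Qed.

(** * Distances and colours in coordinates *)

Definition pdist (n i p j r : nat) : nat :=
  if i == j then cdist n p r
  else if i < j then cdist n p 1 + (2 * (j - i)).-1 + cdist n 0 r
  else cdist n r 1 + (2 * (i - j)).-1 + cdist n 0 p.

Lemma pdistC n i p j r : pdist n i p j r = pdist n j r i p.
Proof. by rewrite /pdist eq_sym cdistC; case: ltngtP. Qed.

Lemma pdist_adj n i p j r r' :
    p < n -> r < n -> r' < n -> 1 < n -> cadj n r r' ->
  pdist n i p j r' <= (pdist n i p j r).+1.
Proof.
move=> pn rn rn' n1 ar; rewrite /pdist.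
case: ifP => _; first exact: cdist_adj.
case: ifP => _; first by rewrite -addnS leq_add2l; apply: cdist_adj => //; lia.
by rewrite -!addSn !leq_add2r !(cdistC _ _ 1); apply: cdist_adj.
Qed.

Lemma pdist_bridge n i p j : p < n -> 1 < n ->
  pdist n i p j.+1 0 <= (pdist n i p j 1).+1 /\
  pdist n i p j 1 <= (pdist n i p j.+1 0).+1.
Proof.
move=> pn n1.
have a01 : cadj n 0 1 by rewrite /cadj /csucc; case: ifP; lia.
have a10 : cadj n 1 0 by rewrite /cadj orbC.
have n0 := ltnW n1.
have := cdist_adj pn n1 n0 a10; have := cdist_adj pn n0 n1 a01.
have d00 : cdist n 0 0 = 0 by rewrite /cdist min0n.
have d11 : cdist n 1 1 = 0 by rewrite /cdist min0n.
have d01 : cdist n 0 1 = 1 by rewrite /cdist; lia.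
rewrite /pdist d00 d11 d01 !(cdistC n 0 p); move: (cdist n) => D.
by do ![case: ifP => ?]; lia.
Qed.

(* Shifted down by one, as in [colour]. *)
Definition colour_at (i p : nat) : nat :=
  if ~~ odd p then 0
  else if p %% 4 == 3 then 2
  else if (p == 1) && odd i then (if i %% 4 == 1 then 3 else 4)
  else 1.

Variant colour_at_spec (i p : nat) : nat -> Type :=
  | Colour1 of ~~ odd p : colour_at_spec i p 0
  | Colour2 of p %% 4 = 1 & (p != 1) || ~~ odd i : colour_at_spec i p 1
  | Colour3 of p %% 4 = 3 : colour_at_spec i p 2
  | Colour4 of p = 1 & i %% 4 = 1 : colour_at_spec i p 3
  | Colour5 of p = 1 & i %% 4 = 3 : colour_at_spec i p 4.

Lemma colour_atP i p : colour_at_spec i p (colour_at i p).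
Proof.
rewrite /colour_at; case: ifP => [|/negbFE op]; first by constructor.
case: eqP => [?|n3]; first by constructor.
case: ifP => [/andP[/eqP p1 oi]|H]; last by constructor; lia.
by case: eqP => ?; constructor => //; lia.
Qed.

Lemma colour_at_pdist_lt n i p j r :
    4 %| n -> p < n -> r < n -> i < j ->
  colour_at i p = colour_at j r -> (colour_at i p).+2 <= pdist n i p j r.
Proof.
case/dvdnP=> s -> pn rn ij; rewrite /pdist ltn_eqF // ij.
by case: colour_atP => [?|??|?|??|??]; case: colour_atP => [?|??|?|??|??] // _;
  rewrite /cdist; lia.
Qed.

Lemma colour_at_pdist_same n i p r :
    4 %| n -> p < n -> r < n -> p < r ->
  colour_at i p = colour_at i r -> (colour_at i p).+2 <= pdist n i p i r.
Proof.
case/dvdnP=> s -> pn rn pr; rewrite /pdist eqxx.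
by case: colour_atP => [?|??|?|??|??]; case: colour_atP => [?|??|?|??|??] // _;
  rewrite /cdist; lia.
Qed.

Lemma colour_at_pdist n i p j r :
    4 %| n -> p < n -> r < n -> (i != j) || (p != r) ->
  colour_at i p = colour_at j r -> (colour_at i p).+2 <= pdist n i p j r.
Proof.
move=> n4 pn rn; case: (ltngtP i j) => [ij _|ji _|<-] /=.
- exact: colour_at_pdist_lt.
- by move=> cE; rewrite pdistC cE; apply: colour_at_pdist_lt.
case: (ltngtP p r) => // [pr|rp] _; first exact: colour_at_pdist_same.
by move=> cE; rewrite pdistC cE; apply: colour_at_pdist_same.
Qed.

(** * The product of a path and cycles *)

Section Product.

Variables (m n : nat) (q : 'I_(m %/ 2) -> 'I_2 -> 'I_n).
Hypothesis n4 : 4 <= n.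
Hypothesis hq : forall i, is_path_in (@cycle_graph n) (q i).

Local Notation E := (@path_aligned_product m 2 'I_n (@cycle_graph n) q).
Local Notation V := ('I_(m %/ 2) * 'I_n)%type.
Local Notation o0 := (@Ordinal 2 0 isT).
Local Notation o1 := (@Ordinal 2 1 isT).

Let n0 : 0 < n. Proof. by lia. Qed.

Lemma ord2P (a : 'I_2) : a = o0 \/ a = o1.
Proof. by case: a => [[|[|k]] ka] //; [left|right]; apply/val_inj. Qed.

Lemma q_adj i : cycle_graph (q i o0) (q i o1).
Proof. by have [_] := hq i; apply. Qed.

Lemma product_sym : symmetric E.
Proof.
have sE u v : E u v -> E v u; last by move=> u v; apply/idP/idP; apply: sE.
case/orP => [/andP[uv euv]|/existsP[a /existsP[b /and3P[ua vb ab]]]].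
  by apply/orP; left; rewrite eq_sym uv cycle_graph_sym.
apply/orP; right; apply/existsP; exists b; apply/existsP; exists a.
by rewrite ua vb orbC.
Qed.

Lemma product_cycle i x y : cycle_graph x y -> E (i, x) (i, y).
Proof. by rewrite /path_aligned_product /= eqxx => ->. Qed.

Lemma product_bridge (i j : 'I_(m %/ 2)) :
  j = i.+1 :> nat -> E (i, q i o1) (j, q j o0).
Proof.
move=> ij; apply/orP; right; apply/existsP; exists o1; apply/existsP; exists o0.
by rewrite !eqxx /= ij; apply/orP; left; lia.
Qed.

Lemma product_edgeP (u v : V) : E u v ->
  [\/ u.1 = v.1 /\ cycle_graph u.2 v.2,
      [/\ v.1 = u.1.+1 :> nat, u.2 = q u.1 o1 & v.2 = q v.1 o0]
    | [/\ u.1 = v.1.+1 :> nat, v.2 = q v.1 o1 & u.2 = q u.1 o0]].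
Proof.
case: u v => [i x] [j y] /orP[/andP[/eqP]|]/=; first by move=> *; constructor 1.
case/existsP=> a /existsP[b /and3P[/eqP -> /eqP ->]].
case: (ord2P a) => ->; case: (ord2P b) => -> /= H.
- by lia.
- have [ij|ij] : i = j :> nat \/ i = j.+1 :> nat by lia.
    by rewrite (val_inj ij); constructor 1; split=> //; apply: q_adj.
  by constructor 3.
- have [ij|ij] : i = j :> nat \/ j = i.+1 :> nat by lia.
    rewrite (val_inj ij); constructor 1; split=> //.
    by rewrite cycle_graph_sym; apply: q_adj.
  by constructor 2.
- by lia.
Qed.

Definition vcoord (u : V) : nat := coord n (q u.1 o0) (q u.1 o1) u.2.

Lemma ltn_vcoord u : vcoord u < n.
Proof. exact: ltn_coord. Qed.

Lemma vcoord0 i x : x = q i o0 -> vcoord (i, x) = 0.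
Proof. by move=> ->; apply: coord0. Qed.

Lemma vcoord1 i x : x = q i o1 -> vcoord (i, x) = 1.
Proof.
by move=> ->; apply: coord1; rewrite -?cycle_graph_cadj ?q_adj //; apply: leq_trans n4.
Qed.

Lemma leq_pdist_dist u v :
  connect E u v -> pdist n u.1 (vcoord u) v.1 (vcoord v) <= dist E u v.
Proof.
apply: (lipschitz_leq_dist (D := fun v : V => pdist n u.1 (vcoord u) v.1 (vcoord v))).
  by rewrite /pdist eqxx /cdist !subnn min0n.
have un := ltn_vcoord u; have n1 : 1 < n by lia.
move=> [i x] [j y] /product_edgeP[[/= ij exy]|[/= ij xq yq]|[/= ij yq xq]].
- rewrite ij in exy *; apply: pdist_adj => //; try exact: ltn_vcoord.
  by apply: coord_adj; rewrite -?cycle_graph_cadj.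
- by rewrite ij (vcoord1 xq) (vcoord0 yq); case: (pdist_bridge u.1 i un n1).
- by rewrite ij (vcoord0 xq) (vcoord1 yq); case: (pdist_bridge u.1 j un n1).
Qed.

Lemma product_colorable k :
    4 %| n -> (forall i p, i < m %/ 2 -> colour_at i p <= k) ->
  packing_colorable E k.+1.
Proof.
move=> n4dvd ck; apply/existsP.
exists [ffun u : V => inord (colour_at u.1 (vcoord u))].
apply/forallP=> u; apply/forallP=> v; apply/implyP=> /and3P[uv].
rewrite !ffunE /colour -val_eqE /= !inordK ?ltnS ?ck // addn1.
move=> /eqP cuv /leq_pdist_dist; apply: leq_trans.
apply: colour_at_pdist => //; try exact: ltn_vcoord.
apply: contraNT uv; rewrite negb_or !negbK => /andP[/eqP/val_inj uv1 /eqP].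
case: u v uv1 {cuv} => [i x] [j y] /= -> /coord_inj H.
by apply/eqP; congr pair; apply/val_inj/H.
Qed.

Lemma has_walk_cycle i k d :
  has_walk E d (i, cyc_ord n0 k) (i, cyc_ord n0 (k + d)).
Proof.
elim: d => [|d IH]; first by rewrite addn0 has_walk0.
rewrite addnS -(addn1 d); apply: has_walkD IH _.
exact/has_walk1/product_cycle/cyc_ord_adj.
Qed.

Lemma has_walk_cycle_dist i k l :
  has_walk E ((k - l) + (l - k)) (i, cyc_ord n0 k) (i, cyc_ord n0 l).
Proof.
case: (leqP k l) => [kl|/ltnW lk].
  have -> : (k - l) + (l - k) = l - k by lia.
  by rewrite -{2}(subnKC kl); apply: has_walk_cycle.
have -> : (k - l) + (l - k) = k - l by lia.
apply: (has_walk_sym product_sym).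
by rewrite -{2}(subnKC lk); apply: has_walk_cycle.
Qed.

Section Coloured.

Variables (k : nat) (c : {ffun V -> 'I_k}).
Hypothesis pc : packing_coloring E c.

Lemma colour_word i b l h : k <= h ->
  [seq colour (c (i, cyc_ord n0 j)) | j <- iota b l] \in packing_words h l.
Proof.
move=> kh; apply: (mem_packing_words (f := fun j => colour (c (i, cyc_ord n0 j)))).
  by move=> j; rewrite /colour /=; apply: leq_trans kh.
move=> j d /andP[d0 d3] [] /val_inj cE.
apply: (packing_coloring_walk pc _ (has_walk_cycle i j d) cE).
by rewrite xpair_eqE eqxx /= cyc_ord_neq // d0; lia.
Qed.

Lemma product_not_2colorable (i : 'I_(m %/ 2)) : ~ k <= 2.
Proof. by move=> k2; have := colour_word i 0 4 k2; rewrite packing_words_2_4. Qed.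

Lemma product_not_3colorable (i j : 'I_(m %/ 2)) : j = i.+1 :> nat -> ~ k <= 3.
Proof.
move=> ij k3.
(* The summand [n] keeps the window of radius [2] around the bridge away from
   truncated subtraction. *)
pose x := q i o1 + n; pose y := q j o0 + n.
have x2 : 2 <= x by rewrite /x; lia.
have y2 : 2 <= y by rewrite /y; lia.
have xE : cyc_ord n0 x = q i o1 by apply: cyc_ordE; rewrite /x modnDr.
have yE : cyc_ord n0 y = q j o0 by apply: cyc_ordE; rewrite /y modnDr.
have := not_joinable (colour_word i (x - 2) 5 k3) (colour_word j (y - 2) 5 k3).
case/negP; apply/allP=> a a5; apply/allP=> b b5; apply/implyP.
rewrite !mem_iota in a5 b5.
rewrite !(nth_map 0) ?size_iota ?nth_iota //; try lia.
move=> /eqP[/val_inj cE]; rewrite -ltnS.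
have wa := has_walk_cycle_dist i (x - 2 + a) x.
have wb := has_walk_cycle_dist j y (y - 2 + b).
have w1 := has_walk1 (product_bridge ij); rewrite -xE -yE in w1.
have := packing_coloring_walk pc _ (has_walkD wa (has_walkD w1 wb)) cE.
rewrite xpair_eqE -val_eqE /= ij ltn_eqF //= => /(_ isT).
by congr (_ < _); lia.
Qed.

End Coloured.

End Product.

Lemma colour_at_leq4 i p : colour_at i p <= 4.
Proof. by rewrite /colour_at; do ![case: ifP => _]. Qed.

Lemma colour_at_leq3 i p : i < 3 -> colour_at i p <= 3.
Proof. by rewrite /colour_at => i3; do ![case: ifP => // ?]; lia. Qed.

Lemma colour_at_leq2 p : colour_at 0 p <= 2.
Proof. by rewrite /colour_at andbF; do ![case: ifP => _]. Qed.

Theorem theorem1 (s t : nat) (hs : 1 <= s) (ht : 1 <= t)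
    (q : 'I_(2 * t %/ 2) -> 'I_2 -> 'I_(4 * s))
    (hq : forall i, is_path_in (@cycle_graph (4 * s)) (q i)) :
  let chi :=
    packing_chromatic_number
      (@path_aligned_product (2 * t) 2 'I_(4 * s) (@cycle_graph (4 * s)) q) in
  [/\ t = 1 -> chi <= 3,
      2 <= t <= 3 -> chi <= 4,
      4 <= t -> chi <= 5,
      t = 1 -> chi = 3
    & 2 <= t <= 3 -> chi = 4].
Proof.
move=> chi; have n4 : 4 <= 4 * s by lia.
have tE : 2 * t %/ 2 = t by rewrite mulKn.
have ub k : (forall i p, i < t -> colour_at i p <= k) -> chi <= k.+1.
  move=> ck; apply/packing_chromatic_number_leq/product_colorable => //.
    exact: dvdn_mulr.
  by move=> i p; rewrite tE; apply: ck.
have i0 : 0 < 2 * t %/ 2 by rewrite tE.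
have ub1 : t = 1 -> chi <= 3.
  by move=> t1; apply: ub => -[|i] p; rewrite t1 // => _; apply: colour_at_leq2.
have ub2 : 2 <= t <= 3 -> chi <= 4.
  by case/andP=> _ t3; apply: ub => i p it; apply/colour_at_leq3/(leq_trans it).
split=> //.
- by move=> _; apply: ub => i p _; apply: colour_at_leq4.
- move=> /ub1 chi3; apply/eqP; rewrite eqn_leq chi3 /=.
  apply: packing_chromatic_number_gtn => k c k2 pc.
  exact: (product_not_2colorable n4 pc (Ordinal i0)).
- move=> t23; apply/eqP; rewrite eqn_leq ub2 //=.
  apply: packing_chromatic_number_gtn => k c k3 pc.
  have i1 : 1 < 2 * t %/ 2 by rewrite tE; case/andP: t23.
  exact: (@product_not_3colorable _ _ _ n4 _ _ pc (Ordinal i0) (Ordinal i1)).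
Qed.
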